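(* A finite group $G$ has exactly $|G|-5$ cyclic subgroups if and only if $G$ is isomorphic to one of the following groups: $C_7$, $D_{14}$, or $C_3\rtimes C_4$.
   Context: $C_n$ denotes the cyclic group of order $n$, and $D_{2n}$ denotes the dihedral group of order $2n$. $H\rtimes K$ denotes a semidirect product of $H$ by $K$ ($H$ normal); the notation $H\rtimes K$ by convention includes the possibility that the semidirect product is a direct product, and the action in $C_3\rtimes C_4$ is not specified in the statement. The trivial subgroup counts as a cyclic subgroup.
   Formalization: The semidirect product C_3⋊C_4 is required to have a nontrivial action: the direct product C_3×C_4 = C_12, which the notation would allow, has 6 = 12−6 cyclic subgroups and so does not satisfy the claim. *)

(* Defs.v *)
From mathcomp Require Import all_boot all_fingroup zmodp all_solvable.
Set Implicit Arguments.
Unset Strict Implicit.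
Unset Printing Implicit Defensive.
Local Open Scope group_scope.

Definition cyclic_subgroups (gT : finGroupType) (G : {group gT}) :
    {set {group gT}} :=
  [set H in subgroups G | cyclic H].

(* The direct product C_3 x C_4 = C_12 has |G| - 6 cyclic subgroups, so the
   action in C_3 : C_4 must be nontrivial; it is then inversion through C_4 ->>
   Aut C_3, and the product is determined up to isomorphism. *)
Definition nontrivial_action (aT rT : finGroupType) (D : {set aT}) (R : {set rT})
    (to : groupAction D R) : Prop :=
  exists a : aT, exists x : rT, [/\ a \in D, x \in R & to x a <> x].

(* Main.v *)
(** Counting generators, |G| is the sum of phi(|C|) over the cyclic subgroups C,
    so the hypothesis says that the sum of phi(|C|) - 1 is 5. This sum is
    monotone in G, so every cyclic subgroup of order n satisfies
    n - d(n) <= 5 with d(n) the number of divisors, hence n <= 8. With a_n the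
    number of cyclic subgroups of order n, this reads
      a_3 + a_4 + a_6 + 3 (a_5 + a_8) + 5 a_7 = 5.
    An element of prime order p commutes with some element of order n as soon
    as p does not divide a_n phi(n); for coprime p and n with pn > 8 this is
    impossible, which leaves few cases.
    - a_7 = 1: the elements outside C_7 are involutions, so G is C_7 or D_14.
    - a_5 = 1 or a_8 = 1: impossible.
    - a_3 + a_4 + a_6 = 5: by Frobenius' theorem on x^3 = 1, a_3 is 0, 1 or 4;
      a_3 = 0 gives a 2-group, excluded by counting modulo 4 the solutions of
      x^2 = 1 in the centralizer of a normal C_4; a_3 = 4 is impossible, and
      a_3 = 1 forces a_4 = 3, a_6 = 1 and |G| = 12. *)

Require Import Defs.
From mathcomp Require Import all_boot all_fingroup zmodp all_solvable.
From mathcomp Require Import zify.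
Set Implicit Arguments.
Unset Strict Implicit.
Unset Printing Implicit Defensive.
Local Open Scope group_scope.

(** * Cyclic subgroups and elements counted by order *)

Lemma size_divisors_leq n : 0 < n -> size (divisors n) <= (n./2).+1.
Proof.
move=> n_gt0.
(* A divisor other than [n] is at most [n./2]. *)
have ->: (n./2).+1 = size (n :: iota 1 n./2) by rewrite /= size_iota.
apply: uniq_leq_size (divisors_uniq n) _ => d.
rewrite -dvdn_divisors // inE mem_iota => /dvdnP[[|[|k]] def_n]; nia.
Qed.

Section CyclicSubgroups.

Variables (gT : finGroupType) (G : {group gT}).

Definition cyclic_subgroups_of (n : nat) := [set C in cyclic_subgroups G | #|C| == n].

Definition elements_of_order (n : nat) := [set x in G | #[x] == n].

Lemma cycle_cyclic_subgroups x : x \in G -> <[x]>%G \in cyclic_subgroups G.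
Proof. by move=> Gx; rewrite !inE cycle_subG Gx cycle_cyclic. Qed.

Lemma cycle_cyclic_subgroups_of x n :
  x \in G -> #[x] = n -> <[x]>%G \in cyclic_subgroups_of n.
Proof.
by move=> Gx ox; rewrite inE cycle_cyclic_subgroups //= -orderE ox.
Qed.

Lemma card_generators (C : {group gT}) :
  cyclic C -> #|[set x | <[x]>%G == C]| = totient #|C|.
Proof.
case/cyclicP=> x defC; rewrite defC -orderE totient_gen; apply: eq_card => y.
by rewrite !inE /generator -defC eq_sym.
Qed.

(** Each element generates one cyclic subgroup, and each [C] arises from its [totient #|C|]
    generators. *)
Lemma sum_totient_cyclic_subgroups :
  \sum_(C in cyclic_subgroups G) totient #|C| = #|G|.
Proof.
rewrite -[RHS]sum1_card.
rewrite (partition_big (fun x => <[x]>%G) [in cyclic_subgroups G]) /=; last first.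
  by move=> x; apply: cycle_cyclic_subgroups.
apply: eq_bigr => C; rewrite !inE => /andP[sCG cycC].
rewrite -card_generators // -sum1_card; apply: eq_bigl => x; rewrite inE.
apply/idP/andP=> [/eqP defC|[]//]; split; last by rewrite defC.
by apply: (subsetP sCG); rewrite -defC cycle_id.
Qed.

Lemma card_elements_of_order n : #|elements_of_order n| = (#|cyclic_subgroups_of n| * totient n)%N.
Proof.
rewrite -[LHS]sum1_card.
rewrite (partition_big (fun x => <[x]>%G) [in cyclic_subgroups_of n]) /=; last first.
  by move=> x; rewrite inE => /andP[Gx /eqP]; apply: cycle_cyclic_subgroups_of.
rewrite -sum_nat_const.
apply: eq_bigr => C; rewrite !inE -andbA => /and3P[sCG cycC /eqP <-].
rewrite -card_generators // -[RHS]sum1_card; apply: eq_bigl => x; rewrite !inE.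
apply/idP/idP=> [/andP[]//|/eqP defC]; rewrite -[C in _ && (_ == C)]defC eqxx.
rewrite -defC -orderE eqxx !andbT.
by apply: (subsetP sCG); rewrite -defC cycle_id.
Qed.

Lemma sum_totient_pred_cyclic_subgroups :
  \sum_(C in cyclic_subgroups G) (totient #|C|).-1 + #|cyclic_subgroups G| = #|G|.
Proof.
rewrite -sum_totient_cyclic_subgroups -sum1_card -big_split /=.
by apply: eq_bigr => C _; rewrite addn1 prednK // totient_gt0 cardG_gt0.
Qed.

(** A subgroup of a cyclic group is determined by its order. *)
Lemma card_cyclic_subgroups_cyclic :
  cyclic G -> #|cyclic_subgroups G| <= size (divisors #|G|).
Proof.
move=> cycG; rewrite cardE -(size_map (fun C : {group gT} => #|C|)).
apply: uniq_leq_size => [|n /mapP[C]]; last first.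
  by rewrite mem_enum !inE => /andP[sCG _] ->; rewrite -dvdn_divisors ?cardSg.
rewrite map_inj_in_uniq ?enum_uniq // => A B.
rewrite !mem_enum !inE => /andP[sAG _] /andP[sBG _] eqAB.
by apply/val_inj/eqP; rewrite (eq_subG_cyclic cycG) ?eqAB.
Qed.

End CyclicSubgroups.

(** * Bound on element orders and the weighted count *)

Section OrderBound.

Variables (gT : finGroupType) (G : {group gT}).

Hypothesis cG : #|cyclic_subgroups G| + 5 = #|G|.

Lemma sum_totient_pred : \sum_(C in cyclic_subgroups G) (totient #|C|).-1 = 5.
Proof. by have := sum_totient_pred_cyclic_subgroups G; lia. Qed.

(* The excess [#|H| - #|cyclic_subgroups H|] is monotone in [H]; on a cyclic
   group of order n it is n minus the number of divisors of n. *)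
Lemma order_leq8 x : x \in G -> #[x] <= 8.
Proof.
move=> Gx; have := sum_totient_pred_cyclic_subgroups <[x]>; rewrite -orderE.
have := card_cyclic_subgroups_cyclic (cycle_cyclic x); rewrite -orderE.
have: \sum_(C in cyclic_subgroups <[x]>) (totient #|C|).-1 <= 5.
  rewrite -sum_totient_pred; apply: sub_le_big => //= [m n|C]; first exact: leq_addr.
  by rewrite !inE => /andP[sCx ->]; rewrite (subset_trans sCx) ?cycle_subG.
move: (\sum_(C in _) _) #|_| => s c le_s5 le_c def_x.
have le_x: #[x] <= size (divisors #[x]) + 5 by lia.
have := size_divisors_leq (order_gt0 x) => le_d.
(* Half-size divisor bounds leave orders up to 12; the exact divisor counts then exclude 9 to 12. *)
have{le_d}: #[x] < 13 by lia.
by move: #[x] le_x; do 13!case=> //.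
Qed.

(** The weights are phi(n) - 1, which vanishes for n = 1 and n = 2. *)
Lemma weighted_count :
  let a (n : nat) := #|cyclic_subgroups_of G n| in
  a 3 + a 4 + a 6 + 3 * (a 5 + a 8) + 5 * a 7 = 5.
Proof.
move=> a; rewrite -[RHS]sum_totient_pred.
(* [inord] is faithful here, since cyclic subgroups have order at most 8. *)
rewrite (partition_big (fun C : {group gT} => inord #|C| : 'I_9) predT) //=.
transitivity (\sum_(i < 9) a i * (totient i).-1); last first.
  apply: eq_bigr => i _; rewrite -sum_nat_const.
  have inord_eq C : C \in cyclic_subgroups G -> (inord #|C| == i) = (#|C| == i).
    rewrite !inE => /andP[sCG /cyclicP[x defC]]; rewrite -val_eqE /= inordK //.
    by rewrite defC -orderE ltnS order_leq8 // -cycle_subG -defC.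
  apply: eq_big => [C|C].
    rewrite inE; case CG: (C \in _) => //=; exact/esym/inord_eq.
  by rewrite inE => /andP[_ /eqP ->].
rewrite !big_ord_recr big_ord0 /=.
have ->: totient 0 = 0 by []. lia.
Qed.

End OrderBound.

(** * Commuting elements from fixed points *)

(** The p-group [<[x]>] acts by conjugation on the elements of order [n], and the number of fixed
    points is congruent to their number modulo [p]. *)
Lemma exists_commute_of_order (gT : finGroupType) (G : {group gT}) (p n : nat) (x : gT) :
    prime p -> x \in G -> #[x] = p -> ~~ (p %| #|elements_of_order G n|) ->
  exists2 y, y \in elements_of_order G n & commute x y.
Proof.
move=> p_pr Gx ox p'n; have pX: p.-group <[x]>.
  by rewrite /pgroup -orderE ox pnat_id.
have actX: [acts <[x]>, on elements_of_order G n | 'J].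
  apply/actsP=> a Xa y; rewrite !inE orderJ groupJr //.
  by apply: subsetP Xa; rewrite cycle_subG.
have := pgroup_fix_mod pX actX.
have [->|[y /setIP[Sy fixy] _]] := set_0Vmem 'Fix_(elements_of_order G n | 'J)(<[x]>).
  by rewrite cards0 mod0n => /eqP; rewrite -/(_ %| _) (negPf p'n).
exists y => //; apply/commute_sym/commgP/conjg_fixP.
exact: (afixP fixy x (cycle_id x)).
Qed.

Lemma exists_order_mul (gT : finGroupType) (G : {group gT}) (p n : nat) (x : gT) :
    prime p -> coprime p n -> x \in G -> #[x] = p ->
    ~~ (p %| #|elements_of_order G n|) ->
  exists2 y, y \in G & #[y] = (p * n)%N.
Proof.
move=> p_pr co_pn Gx ox p'n.
have [y] := exists_commute_of_order p_pr Gx ox p'n.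
rewrite inE => /andP[Gy /eqP oy] cxy.
by exists (x * y); [apply: groupM | rewrite orderM ?ox ?oy].
Qed.

(** * Consequences of the number of cyclic subgroups of a given order *)

Section CyclicSubgroupsOf.

Variables (gT : finGroupType) (G : {group gT}).

Lemma cyclic_subgroups_of_gt0 n :
  0 < #|cyclic_subgroups_of G n| -> exists2 x, x \in G & #[x] = n.
Proof.
case/card_gt0P=> C; rewrite !inE -andbA => /and3P[sCG /cyclicP[x defC] /eqP oC].
by exists x; [rewrite -cycle_subG -defC | rewrite orderE -defC].
Qed.

Lemma cyclic_subgroups_of_eq0 n x :
  #|cyclic_subgroups_of G n| = 0 -> x \in G -> #[x] <> n.
Proof.
move/eqP; rewrite cards_eq0 => /eqP a0 Gx ox.
by have := cycle_cyclic_subgroups_of Gx ox; rewrite a0 inE.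
Qed.

Lemma cyclic_subgroups_of_eq1 n x y :
    #|cyclic_subgroups_of G n| = 1%N ->
  x \in G -> y \in G -> #[x] = n -> #[y] = n -> <[x]> = <[y]>.
Proof.
move/eqP/cards1P=> [C a1] Gx Gy ox oy.
have := cycle_cyclic_subgroups_of Gx ox; have := cycle_cyclic_subgroups_of Gy oy.
by rewrite a1 !inE => /eqP eqyC /eqP eqxC; apply: congr_group; rewrite eqxC.
Qed.

Lemma cyclic_subgroups_of_eq1_norm n x :
    #|cyclic_subgroups_of G n| = 1%N -> x \in G -> #[x] = n ->
  G \subset 'N(<[x]>).
Proof.
move=> a1 Gx ox; apply/subsetP=> g Gg; rewrite inE -cycleJ.
by rewrite (cyclic_subgroups_of_eq1 a1 (y := x)) ?groupJ ?orderJ.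
Qed.

Lemma cyclic_subgroups_of_eq1_mem n x y :
    #|cyclic_subgroups_of G n| = 1%N ->
  x \in G -> y \in G -> #[x] = n -> #[y] = n -> y \in <[x]>.
Proof.
by move=> a1 Gx Gy ox oy; rewrite (cyclic_subgroups_of_eq1 a1 Gx Gy ox oy) cycle_id.
Qed.

Lemma cyclic_subgroups_of_dvdn m n :
  m %| n -> 0 < m -> 0 < n -> 0 < #|cyclic_subgroups_of G n| -> 0 < #|cyclic_subgroups_of G m|.
Proof.
move=> /dvdnP[k ->] m_gt0 km_gt0 /cyclic_subgroups_of_gt0[x Gx ox]; apply/card_gt0P.
have k_gt0: 0 < k by move: km_gt0; rewrite muln_gt0 => /andP[].
exists <[x ^+ k]>%G; apply: cycle_cyclic_subgroups_of; first exact: groupX.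
by rewrite orderXdiv ox ?dvdn_mulr // mulKn.
Qed.

End CyclicSubgroupsOf.

(** * Unions of cosets, and cycles with two generators *)

(** The hypothesis makes [A] a union of right cosets of [H]. *)
Lemma card_lsaturated (gT : finGroupType) (H : {group gT}) (A : {set gT}) :
  H * A = A -> #|A| = (#|rcosets H A| * #|H|)%N.
Proof.
move=> defA; rewrite -sum1_card.
rewrite (partition_big (rcoset H) [in rcosets H A]) /=; last first.
  by move=> x Ax; apply: imset_f.
rewrite -sum_nat_const; apply: eq_bigr => _ /rcosetsP[y Ay ->].
rewrite -(card_rcoset H y) -sum1_card; apply: eq_bigl => x.
rewrite !rcosetE (sameP eqP (rcoset_eqP)).
case Hx: (x \in H :* y); rewrite ?andbF // andbT -defA.
by apply: subsetP Hx; rewrite mulgS ?sub1set.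
Qed.

Lemma card_quotient_lsaturated (gT : finGroupType) (H : {group gT}) (A : {set gT}) :
  A \subset 'N(H) -> H * A = A -> #|A| = (#|A / H| * #|H|)%N.
Proof.
move=> nHA defA; rewrite (card_lsaturated defA); congr (_ * _)%N.
by rewrite -[in LHS](setIidPl nHA) -val_quotient card_imset //; apply: val_inj.
Qed.

Lemma cycle_mul_closed (gT : finGroupType) (d : gT) (A : {set gT}) :
  {in A, forall x, d * x \in A} -> <[d]> * A = A.
Proof.
move=> Ad; apply/eqP; rewrite eqEsubset mulG_subr andbT.
apply/subsetP=> _ /mulsgP[_ x /cycleP[i ->] Ax ->].
by elim: i => [|i IHi]; rewrite ?mul1g // expgS -mulgA Ad.
Qed.

(** Both [d] and [d^-1] are generators, and they differ: otherwise [d] would have order 1 or 2, with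
    totient 1. *)
Lemma cycle_generator_totient2 (gT : finGroupType) (d y : gT) :
  totient #[d] = 2 -> y \in <[d]> -> #[y] = #[d] -> y = d \/ y = d^-1.
Proof.
move=> tot_d Dy oy; suff: y \in [set d; d^-1] by rewrite !inE => /orP[]/eqP; [left|right].
have /eqP->: [set d; d^-1] == [set x | generator <[d]> x].
  rewrite eqEcard subUset !sub1set !inE generator_cycle /generator cycleV eqxx /=.
  rewrite -totient_gen tot_d cards2; case: eqP => // d1.
  have: #[d] %| 2 by rewrite order_dvdn expgS expg1 [X in d * X]d1 mulgV.
  by rewrite dvdn_divisors // !inE => /orP[] /eqP od; move: tot_d; rewrite od.
rewrite inE /generator.
by rewrite (eq_subG_cyclic (cycle_cyclic d)) ?cycle_subG ?cycle_id // -!orderE oy.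
Qed.

Lemma conjg_totient2 (gT : finGroupType) (d g : gT) :
  totient #[d] = 2 -> g \in 'N(<[d]>) -> d ^ g = d \/ d ^ g = d^-1.
Proof.
by move=> tot_d Ng; apply: cycle_generator_totient2; rewrite ?orderJ ?memJ_norm ?cycle_id.
Qed.

Lemma index_cent1_totient2 (gT : finGroupType) (G : {group gT}) (d : gT) :
  totient #[d] = 2 -> G \subset 'N(<[d]>) -> #|G : 'C_G[d]| <= 2.
Proof.
move=> tot_d nDG; rewrite index_cent1.
apply: (@leq_trans #|[set d; d^-1]|); last by rewrite cards2; case: (_ != _).
apply: subset_leq_card; apply/subsetP=> _ /imsetP[g /(subsetP nDG) Ng ->].
by case: (conjg_totient2 tot_d Ng) => ->; rewrite !inE eqxx ?orbT.
Qed.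

(* With z = d^2, multiplication by d swaps the solutions of x^2 = 1 and
   x^2 = z, and both together are the preimage of the solutions of x^2 = 1
   in K / <[d]>, whose number is even. *)
Lemma dvd4_Ldiv2 (gT : finGroupType) (K : {group gT}) (d : gT) :
    d \in K -> #[d] = 4 -> K \subset 'C[d] ->
    {in K, forall x, x ^+ 4 = 1} -> 8 %| #|K| ->
  4 %| #|'Ldiv_2(K)|.
Proof.
move=> Kd od cKd expK K8.
have cdx x : x \in K -> commute d x.
  by move=> Kx; have /cent1P := subsetP cKd x Kx; apply: commute_sym.
have d4: d ^+ 4 = 1 by rewrite -od expg_order.
have d2: d ^+ 2 != 1 by rewrite -order_dvdn od.
have nDK: K \subset 'N(<[d]>) by rewrite cents_norm // cent_cycle.
pose P := [set x in K | x ^+ 2 \in <[d]>].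
have sPK: P \subset K by apply/subsetP=> x; rewrite inE => /andP[].
have satP: <[d]> * P = P.
  apply: cycle_mul_closed => x; rewrite !inE => /andP[Kx Dx2].
  by rewrite (groupM Kd Kx) (expgMn 2 (cdx x Kx)) groupM ?mem_cycle.
have cardP: #|P| = (#|'Ldiv_2(K / <[d]>)| * 4)%N.
  rewrite (card_quotient_lsaturated (subset_trans sPK nDK) satP) -orderE od.
  congr (#|(_ : {set _})| * _)%N; apply/setP=> xbar; apply/idP/LdivP.
    case/morphimP=> x Nx; rewrite inE => /andP[Kx Dx2] ->.
    by split; [exact: mem_quotient | rewrite -morphX //= coset_id].
  case=> /morphimP[x Nx Kx ->]; rewrite -morphX //= => /(coset_idr (groupX 2 Nx)) Dx2.
  by apply: mem_morphim Nx _; rewrite inE Kx Dx2.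
have defP: P = 'Ldiv_2(K) :|: d *: 'Ldiv_2(K).
  apply/setP=> x; rewrite !inE mem_lcoset !inE (groupMl _ (groupVr Kd)).
  case Kx: (x \in K) => //=; have cdVx := commuteV (commute_sym (cdx x Kx)).
  rewrite expgMn; last exact: commute_sym.
  rewrite expgVn.
  apply/idP/orP => [Dx2|[/eqP->|]]; rewrite ?group1 //; last first.
    by rewrite -eq_invg_mul invgK => /eqP <-; rewrite mem_cycle.
  have [|ne1] := eqVneq (x ^+ 2) 1; [by left | right].
  rewrite -eq_invg_mul invgK; apply/eqP.
  (* A nontrivial [x ^+ 2] in [<[d]>] is an involution, and [d ^+ 2] is the only one there. *)
  have od2: #[d ^+ 2] = 2 by apply: nt_prime_order; rewrite // -expgM d4.
  have ox2: #[x ^+ 2] = 2 by apply: nt_prime_order; rewrite // -expgM expK.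
  have eq_cyc: <[x ^+ 2]> = <[d ^+ 2]>.
    apply/eqP; rewrite (eq_subG_cyclic (cycle_cyclic d)) ?cycle_subG ?mem_cycle //.
    by rewrite -!orderE ox2 od2.
  have:= cycle_id (d ^+ 2); rewrite -eq_cyc cycle2g // !inE (negPf d2).
  by move/eqP.
have disjP: 'Ldiv_2(K) :&: d *: 'Ldiv_2(K) = set0.
  apply/setP=> x; rewrite !inE mem_lcoset !inE.
  apply/negP; move=> /andP[/andP[Kx /eqP x2] /andP[_]].
  rewrite expgMn; last exact/commute_sym/commuteV/commute_sym/cdx.
  by rewrite x2 mulg1 expgVn invg_eq1 (negPf d2).
have evenQ: 2 %| #|'Ldiv_2(K / <[d]>)|.
  apply: Frobenius_Ldiv; rewrite card_quotient //.
  have sDK: <[d]> \subset K by rewrite cycle_subG.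
  by move: K8; rewrite -(Lagrange sDK) -orderE od (@dvdn_pmul2l 4 2).
have := cardP; rewrite defP cardsU disjP cards0 card_lcoset subn0.
(* The size of [P] is twice the wanted number and also four times an even number. *)
have /dvdnP[q ->] := evenQ; rewrite addnn -muln2 => eq_card.
by apply/dvdnP; exists q; lia.
Qed.

(** * From the count to the groups: no elements of order 5 or 8 *)

Section Forward.

Variables (gT : finGroupType) (G : {group gT}).
Hypothesis cG : #|cyclic_subgroups G| + 5 = #|G|.

Let a (n : nat) := #|cyclic_subgroups_of G n|.

Let count_eq : a 3 + a 4 + a 6 + 3 * (a 5 + a 8) + 5 * a 7 = 5.
Proof. exact: weighted_count. Qed.

(** Otherwise some element would have order [p * n], beyond the bound 8. *)
Lemma dvdn_elements_of_order p n x :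
    prime p -> coprime p n -> 8 < p * n -> x \in G -> #[x] = p ->
  p %| a n * totient n.
Proof.
move=> p_pr co_pn gt8 Gx ox; rewrite -card_elements_of_order; apply/contraT=> p'n.
have [y Gy oy] := exists_order_mul p_pr co_pn Gx ox p'n.
by have := order_leq8 cG Gy; rewrite oy leqNgt gt8.
Qed.

(** If [a 5 > 0], then [a 5 = 1] and [a 3 + a 4 + a 6 = 2]. As 5 divides [a 3] and [a 4], both
    vanish, so [a 6 = 2]; but an element of order 6 has a power of order 3. *)
Lemma no_order_5 : a 5 = 0.
Proof.
have [//|a5_gt0] := posnP (a 5).
have [x Gx ox] := cyclic_subgroups_of_gt0 a5_gt0.
have := @dvdn_elements_of_order 5 3 x isT isT isT Gx ox.
have := @dvdn_elements_of_order 5 4 x isT isT isT Gx ox.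
have: 0 < a 6 -> 0 < a 3 by apply: cyclic_subgroups_of_dvdn.
have [-> ->]: totient 3 = 2 /\ totient 4 = 2 by [].
lia.
Qed.

Lemma order_8_count : 0 < a 8 -> [/\ a 8 = 1%N, a 4 = 2, a 3 = 0, a 6 = 0 & a 7 = 0].
Proof.
move=> a8_gt0; have a5 := no_order_5.
have a3: a 3 = 0.
  have [//|a3_gt0] := posnP (a 3).
  have [x Gx ox] := cyclic_subgroups_of_gt0 a3_gt0.
  have := @dvdn_elements_of_order 3 8 x isT isT isT Gx ox.
  have ->: totient 8 = 4 by [].
  lia.
have: 0 < a 6 -> 0 < a 3 by apply: cyclic_subgroups_of_dvdn.
by split; lia.
Qed.

(** The unique cyclic [<[c]>] of order 8 is normal, and so is the one cyclic [<[d]>] of order 4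
    outside it. Then [[~ d, c]] is central enough and small enough that [c * d] has order 8 as well,
    although it lies outside [<[c]>]. *)
Lemma no_order_8 : a 8 = 0.
Proof.
have [//|a8_gt0] := posnP (a 8); case: (order_8_count a8_gt0) => a8 a4 a3 a6 a7.
have a5 := no_order_5.
have [c Gc oc] := cyclic_subgroups_of_gt0 a8_gt0.
have nCG: G \subset 'N(<[c]>) := cyclic_subgroups_of_eq1_norm a8 Gc oc.
have oc2: #[c ^+ 2] = 4 by rewrite orderXdiv oc.
have Sc2: <[c ^+ 2]>%G \in cyclic_subgroups_of G 4.
  by apply: cycle_cyclic_subgroups_of; rewrite ?groupX.
have [D SD defS4]: exists2 D : {group gT}, D != <[c ^+ 2]>%G
    & cyclic_subgroups_of G 4 = [set D; <[c ^+ 2]>%G].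
  move: a4; rewrite /a (cardsD1 <[c ^+ 2]>%G) Sc2 => /eqP/cards1P[D defD].
  exists D; first by have: D \in [set D] by [rewrite inE]; rewrite -defD !inE => /andP[].
  by rewrite setUC -(setD1K Sc2) defD.
have: D \in cyclic_subgroups_of G 4 by rewrite defS4 !inE eqxx.
rewrite !inE -andbA => /and3P[sDG /cyclicP[d defD] /eqP].
rewrite defD -orderE => od; have Gd: d \in G by rewrite -cycle_subG -defD.
have nc2G: G \subset 'N(<[c ^+ 2]>).
  by apply: char_norm_trans nCG; rewrite cycle_subgroup_char ?cycleX.
have neq_dc: <[d]> != <[c ^+ 2]> by move: SD; rewrite -val_eqE /= defD.
have nDG: G \subset 'N(<[d]>).
  apply/subsetP=> g Gg; rewrite inE -cycleJ.
  have: <[d ^ g]>%G \in cyclic_subgroups_of G 4.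
    by apply: cycle_cyclic_subgroups_of; rewrite ?groupJ ?orderJ.
  rewrite defS4 in_set2 -defD.
  case/orP=> /eqP/(congr1 (@gval gT)) /= eq_dg; first by rewrite eq_dg.
  case/eqP: neq_dc; apply: (@conjsg_inj _ g).
  by rewrite -cycleJ eq_dg (normP (subsetP nc2G g Gg)).
have Cd: d \notin <[c]>.
  apply: contra neq_dc => Cd.
  by rewrite (eq_subG_cyclic (cycle_cyclic c)) ?cycle_subG ?mem_cycle // -!orderE od oc2.
pose z := [~ d, c].
have Cz: z \in <[c]>.
  by rewrite /z commgEr groupMr ?cycle_id // memJ_norm ?groupV ?cycle_id ?(subsetP nCG).
have Dz: z \in <[d]>.
  by rewrite /z commgEl groupMl ?groupV ?cycle_id // memJ_norm ?cycle_id ?(subsetP nDG).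
have z2: z ^+ 2 = 1.
  apply/eqP; rewrite -order_dvdn; have: #[z] %| 4 by rewrite -od order_dvdG.
  (* With order 4, [z] would generate [<[d]>] and put [d] inside [<[c]>]. *)
  have: #[z] != 4.
    apply: contra Cd => /eqP oz; rewrite -cycle_subG.
    have ->: <[d]> = <[z]>; last by rewrite cycle_subG.
    by apply/eqP; rewrite (eq_subG_cyclic (cycle_cyclic d)) ?cycle_subG ?cycle_id // -!orderE od oz.
  by rewrite [_ %| 4]dvdn_divisors // !inE => /[swap] /or3P[] /eqP->.
have cd4: (c * d) ^+ 4 = c ^+ 4.
  (* The commutator enters with exponent 'C(4, 2) = 6, which is even, so [z2] removes it. *)
  rewrite expMg_Rmul; last first.
  - by apply/commute_sym/(centsP (cycle_abelian c)); rewrite ?cycle_id.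
  - by apply/commute_sym/(centsP (cycle_abelian d)); rewrite ?cycle_id.
  by rewrite -{2}od expg_order mulg1 (expgM z 2 3) z2 expg1n mulg1.
have Gcd: c * d \in G by rewrite groupM.
have ocd: #[c * d] = 8.
  have: ~~ (#[c * d] %| 4) by rewrite order_dvdn cd4 -order_dvdn oc.
  have := order_leq8 cG Gcd; have := order_gt0 (c * d).
  have := cyclic_subgroups_of_eq0 a3 Gcd; have := cyclic_subgroups_of_eq0 a5 Gcd.
  have := cyclic_subgroups_of_eq0 a6 Gcd; have := cyclic_subgroups_of_eq0 a7 Gcd.
  by move: #[_]; do 9!case=> //.
have := cyclic_subgroups_of_eq1_mem a8 Gc Gcd oc ocd.
by rewrite groupMl ?cycle_id // (negPf Cd).
Qed.

Let count_eq_3467 : a 3 + a 4 + a 6 + 5 * a 7 = 5.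
Proof. by have := no_order_5; have := no_order_8; lia. Qed.

(** * An element of order 7: the groups C_7 and D_14 *)

Lemma order_7_classification :
  0 < a 7 -> G \isog Zp 7 \/ G \isog 'D_14.
Proof.
move=> a7_gt0; have [a3 a4 a6 a7]: [/\ a 3 = 0, a 4 = 0, a 6 = 0 & a 7 = 1%N].
  by split; lia.
have orders z : z \in G -> [|| #[z] == 1%N, #[z] == 2 | #[z] == 7].
  move=> Gz; have := order_leq8 cG Gz; have := order_gt0 z.
  have := cyclic_subgroups_of_eq0 a3 Gz; have := cyclic_subgroups_of_eq0 a4 Gz.
  have := cyclic_subgroups_of_eq0 no_order_5 Gz.
  have := cyclic_subgroups_of_eq0 a6 Gz.
  have := cyclic_subgroups_of_eq0 no_order_8 Gz.
  by move: #[_]; do 9!case=> //.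
have [x Gx ox] := cyclic_subgroups_of_gt0 a7_gt0.
(* An involution commuting with [x] would give an element of order 14. *)
have cent_x z : z \in G -> commute x z -> z \in <[x]>.
  move=> Gz cxz; case/or3P: (orders z Gz) => /eqP oz.
  - by move/eqP: oz; rewrite order_eq1 => /eqP->.
  - have := order_leq8 cG (groupM Gx Gz).
    by rewrite orderM ?ox ?oz.
  exact: cyclic_subgroups_of_eq1_mem a7 Gx Gz ox oz.
have [sGX | /subsetPn[y Gy Xy]] := boolP (G \subset <[x]>).
  left; have ->: G = <[x]>%G by apply/val_inj/eqP; rewrite eqEsubset sGX /= cycle_subG.
  by rewrite isog_sym -ox Zp_isog.
have order2 z : z \in G -> z \notin <[x]> -> #[z] = 2.
  move=> Gz Xz; case/or3P: (orders z Gz) => /eqP // oz; case/negP: Xz.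
    by move/eqP: oz; rewrite order_eq1 => /eqP->.
  exact: cyclic_subgroups_of_eq1_mem a7 Gx Gz ox oz.
(* Both [z] and [z * x] are involutions, which forces [z] to invert [x]. *)
have inv_x z : z \in G -> z \notin <[x]> -> x ^ z = x^-1.
  move=> Gz Xz; have oz := order2 z Gz Xz.
  have ozx: #[z * x] = 2.
    by apply: order2; [apply: groupM | rewrite groupMr ?cycle_id].
  by rewrite conjgE mulgA (invg2id oz) -(invg2id ozx) invMg -mulgA mulVg mulg1.
right; have oy := order2 y Gy Xy.
have Xyx: y * x \notin <[x]> by rewrite groupMr ?cycle_id.
have oyx := order2 _ (groupM Gy Gx) Xyx.
(* A product of two elements outside [<[x]>] centralizes [x], so it lies in [<[x]>]. Two involutions
   are chosen as generators in order to recognize a dihedral group. *)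
have defG: G = <<[set y; y * x]>> :> {set gT}.
  apply/eqP; rewrite eqEsubset gen_subG subUset !sub1set Gy groupM //= andbT.
  have Hy: y \in <<[set y; y * x]>> by rewrite mem_gen ?set21.
  have sXH: <[x]> \subset <<[set y; y * x]>>.
    by rewrite cycle_subG -(groupMl _ Hy) mem_gen ?set22.
  apply/subsetP=> z Gz; have [/(subsetP sXH)//|Xz] := boolP (z \in <[x]>).
  rewrite -(groupMl _ Hy); apply/(subsetP sXH)/cent_x; first exact: groupM.
  apply/commgP/conjg_fixP; rewrite conjgM inv_x // conjVg inv_x //.
  exact: invgK.
have sGXY: G \subset <[x]> * <[y]>.
  apply/subsetP=> z Gz; have [Xz|Xz] := boolP (z \in <[x]>).
    by apply: subsetP Xz; apply: mulG_subl.
  rewrite -[z](mulgKV y) mem_mulg ?cycle_id //; apply: cent_x.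
    by rewrite groupM ?groupV.
  apply/commgP/conjg_fixP; rewrite (invg2id oy) conjgM inv_x // conjVg inv_x //.
  exact: invgK.
have oG: #|G| = 14.
  apply/eqP; rewrite eqn_leq (leq_trans (subset_leq_card sGXY)) /=.
    apply: dvdn_leq; first exact: cardG_gt0.
    by rewrite (@Gauss_dvd 2 7) // -{1}oy -{1}ox !order_dvdG.
  rewrite coprime_cardMg -!orderE ox oy //.
have ne_y: y != y * x.
  by apply/eqP=> eq_y; move: ox; rewrite -(mulKg y x) -eq_y mulVg order1.
by have := involutions_gen_dihedral oy oyx ne_y; rewrite -defG oG.
Qed.

(** * Orders 3, 4 and 6: reduction to a group of order 12 *)

(** Otherwise [G] is a 2-group of exponent dividing 4 with [a 4 = 5], hence with 10 elements of
    order 4; counting these inside and outside the centralizer of a normal cyclic [<[d]>] shows that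
    4 divides 10. *)
Lemma order_3_exists : a 7 = 0 -> 0 < a 3.
Proof.
move=> a7; rewrite lt0n; apply/eqP=> a3.
have a6: a 6 = 0.
  have: 0 < a 6 -> 0 < a 3 by apply: cyclic_subgroups_of_dvdn.
  by rewrite a3; case: (a 6) => // n /(_ isT).
have a4: a 4 = 5 by lia.
have orders z : z \in G -> #[z] %| 4.
  move=> Gz; have := order_leq8 cG Gz; have := order_gt0 z.
  have := cyclic_subgroups_of_eq0 a3 Gz; have := cyclic_subgroups_of_eq0 no_order_5 Gz.
  have := cyclic_subgroups_of_eq0 a6 Gz; have := cyclic_subgroups_of_eq0 a7 Gz.
  have := cyclic_subgroups_of_eq0 no_order_8 Gz.
  by move: #[_]; do 9!case=> //.
have expG: {in G, forall x, x ^+ 4 = 1}.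
  by move=> z Gz; apply/eqP; rewrite -order_dvdn orders.
have pG: 2.-group G.
  apply/pgroupP=> p p_pr /(Cauchy p_pr)[z Gz oz]; have := orders z Gz.
  by rewrite oz (Euclid_dvdX 2 2) // andbT dvdn_prime2.
have actG: [acts G, on cyclic_subgroups_of G 4 | 'JG].
  apply/actsP=> g Gg C; rewrite !inE /= cyclicJ cardJg.
  by rewrite -{1}(conjGid Gg) conjSg.
(* A 2-group acting on 5 subgroups fixes one of them. *)
have /card_gt0P[D /setIP[SD /afixP fixD]]: 0 < #|'Fix_(cyclic_subgroups_of G 4 | 'JG)(G)|.
  have := pgroup_fix_mod pG actG; rewrite -/(a 4) a4 lt0n.
  by case: #|_|.
move: SD; rewrite !inE -andbA => /and3P[sDG /cyclicP[d defD] /eqP oD].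
have od: #[d] = 4 by rewrite orderE -defD.
have Gd: d \in G by rewrite -cycle_subG -defD.
have nDG: G \subset 'N(<[d]>).
  apply/subsetP=> g Gg; rewrite inE -defD.
  by have /(congr1 (@gval gT)) /= -> := fixD g Gg.
have tot_d: totient #[d] = 2 by rewrite od.
pose K := 'C_G[d]%G; have sKG: K \subset G := subsetIl _ _.
have Kd: d \in K by rewrite inE Gd cent1id.
have iK: #|G : K| <= 2 by apply: index_cent1_totient2.
have cardE4: #|elements_of_order G 4| = 10 by rewrite card_elements_of_order -/(a 4) a4.
have oG: 10 < #|G|.
  have: 1 |: elements_of_order G 4 \subset G.
    rewrite subUset sub1set group1; apply/subsetP=> z; by rewrite inE => /andP[].
  by move/subset_leq_card; rewrite cardsU1 inE order1 andbF cardE4.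
have K8: 8 %| #|K|.
  have /p_natP[k def_k] : 2.-nat #|K| by apply: pgroupS pG.
  (* Otherwise [#|G|] would be at most 8; a power of 2 above 4 is a multiple of 8. *)
  have: 4 < #|K|.
    rewrite ltnNge; apply/negP=> leK.
    have := leq_mul leK iK; rewrite (Lagrange sKG) => leG.
    by have := leq_trans oG leG.
  by rewrite def_k -[4]/(2 ^ 2)%N ltn_exp2l // => lt2k; apply: (@dvdn_exp2l 2 3).
pose A := [set x in G :\: K | x ^+ 2 != 1].
(* Elements outside [K] invert [d], so [(d * x) ^+ 2] is conjugate to [x ^+ 2] and [A] is a union of
   cosets of [<[d]>]. *)
have A4: 4 %| #|A|.
  rewrite (@card_lsaturated _ <[d]>%G) -?orderE ?od ?dvdn_mull //.
  apply: cycle_mul_closed => x; rewrite inE => /andP[/setDP[Gx Kx] x2].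
  have dx: d ^ x = d^-1.
    case: (conjg_totient2 tot_d (subsetP nDG x Gx)) => // dx; case/negP: Kx; rewrite inE Gx /=.
    by apply/cent1P/esym/commgP/conjg_fixP.
  have dx2: (d * x) ^+ 2 = (x ^+ 2) ^ d^-1.
    by rewrite !expgS !expg0 !mulg1 {2}(conjgC d x) dx conjgE invgK !mulgA.
  by rewrite inE dx2 conjg_eq1 x2 andbT; apply/setDP; rewrite groupM // groupMl.
have defE: elements_of_order G 4 = [set x in G | x ^+ 2 != 1].
  apply/setP=> x; rewrite !inE -order_dvdn; case Gx: (x \in G) => //=.
  have := orders x Gx; rewrite [_ %| 4]dvdn_divisors // !inE.
  by case/or3P=> /eqP->.
have := cardE4; rewrite -(cardsID K) defE.
have ->: [set x in G | x ^+ 2 != 1] :\: K = A.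
  by apply/setP=> x; rewrite !inE andbA.
have ->: [set x in G | x ^+ 2 != 1] :&: K = K :\: 'Ldiv_2().
  by apply/setP=> x; rewrite !inE; case: (x \in G); rewrite ?andbF.
have K4: 4 %| #|'Ldiv_2(K)|.
  apply: (dvd4_Ldiv2 Kd od) K8; first exact: subsetIr.
  by move=> x /(subsetP sKG)/expG.
rewrite cardsD => eq10.
suff: 4 %| 10 by [].
rewrite -eq10 dvdn_addl ?dvdn_sub //.
by apply: dvdn_trans K8.
Qed.

(** Frobenius' theorem makes 3 divide [1 + 2 * a 3], so [a 3] is 1 or 4. The value 4 forces
    [a 6 = 1], and then all 8 elements of order 3 would lie in the cyclic group of order 6. *)
Lemma order_3_unique : a 7 = 0 -> a 3 = 1%N.
Proof.
move=> a7; have a3_gt0 := order_3_exists a7.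
have [t Gt ot] := cyclic_subgroups_of_gt0 a3_gt0.
have: 3 %| #|'Ldiv_3(G)| by apply: Frobenius_Ldiv; rewrite -ot order_dvdG.
have ->: 'Ldiv_3(G) = 1 |: elements_of_order G 3.
  apply/setP=> x; rewrite !inE -order_dvdn dvdn_divisors // !inE order_eq1.
  by case: eqP => [->|]; rewrite ?group1.
rewrite cardsU1 card_elements_of_order !inE order1 andbF -/(a 3) /= add1n => dvd3.
have tot3: totient 3 = 2 by []; rewrite tot3 in dvd3.
have [|a3_neq1] := eqVneq (a 3) 1%N; first by [].
have a3: a 3 = 4 by lia.
have := dvdn_elements_of_order (p := 3) (n := 4) isT isT isT Gt ot.
have -> : totient 4 = 2 by [].
rewrite -/(a 4) => dvd4; have a6: a 6 = 1%N by lia.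
have [y Gy oy] : exists2 y, y \in G & #[y] = 6.
  by apply: cyclic_subgroups_of_gt0; rewrite -/(a 6) a6.
suff: #|elements_of_order G 3| <= #|<[y]>|.
  by rewrite card_elements_of_order -/(a 3) a3 -orderE oy.
apply/subset_leq_card/subsetP=> x; rewrite inE => /andP[Gx /eqP ox].
have [|z] := @exists_commute_of_order _ G 3 6 x isT Gx ox.
  by rewrite card_elements_of_order -/(a 6) a6.
rewrite inE => /andP[Gz /eqP oz] cxz.
rewrite (cyclic_subgroups_of_eq1 a6 Gy Gz oy oz).
(* The involution [z ^+ 3] commutes with [x], so the product has order 6. *)
have: x * z ^+ 3 \in <[z]>.
  apply: (cyclic_subgroups_of_eq1_mem a6 Gz (groupM Gx (groupX 3 Gz)) oz).
  by rewrite orderM ?ox ?orderXdiv ?oz //; apply: commuteX.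
by rewrite groupMr ?mem_cycle.
Qed.

(** Splitting an element of order 6 into its parts of order 3 and 2 gives [a 6 = #|I|], with [I] the
    involutions centralizing [t]; by Frobenius' theorem [1 + #|I|] is even. *)
Lemma order_6_odd t :
    a 3 = 1%N -> t \in G -> #[t] = 3 -> 0 < a 6 -> odd (a 6).
Proof.
move=> a3 Gt ot a6_gt0; pose K := 'C_G[t]%G.
pose I := [set u in K | #[u] == 2].
have t4: t ^+ 4 = t by rewrite (expgD t 1 3) -ot expg_order mulg1.
have commK u : u \in K -> commute t u.
  by case/setIP=> _ /cent1P.
have mulI s u : s \in G -> #[s] = 3 -> commute s u -> u \in I ->
    s * u \in elements_of_order G 6.
  move=> Gs os csu; rewrite !inE => /andP[/andP[Gu _] /eqP ou].
  by rewrite groupM ?orderM ?os ?ou.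
have splitE6 y : y \in elements_of_order G 6 ->
    y ^+ 3 \in I /\ (y = t * y ^+ 3 \/ y = t^-1 * y ^+ 3).
  rewrite inE => /andP[Gy /eqP oy].
  have def_y: y = y ^+ 4 * y ^+ 3 by rewrite -expgD (expgD y 1 6) -oy expg_order mulg1.
  have oy4: #[y ^+ 4] = 3 by rewrite orderXgcd oy.
  have t_y4: y ^+ 4 = t \/ y ^+ 4 = t^-1.
    apply: cycle_generator_totient2; rewrite ?ot ?oy4 //.
    exact: cyclic_subgroups_of_eq1_mem a3 Gt (groupX 4 Gy) ot oy4.
  split; last by case: t_y4 => <-; [left | right].
  apply/setIdP; split; last by rewrite orderXdiv oy.
  apply/setIP; split; first exact: groupX.
  have cy4: commute (y ^+ 4) y by apply/commute_sym/commuteX.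
  apply/cent1P/commute_sym/commuteX; case: t_y4 => [<-//|y4].
  by rewrite -[t]invgK -y4; apply/commute_sym/commuteV/commute_sym.
have defE6: elements_of_order G 6 = t *: I :|: t^-1 *: I.
  apply/setP=> y; apply/idP/setUP => [/splitE6[Iy3 [->|->]]|].
  - by left; rewrite mem_lcoset mulKg.
  - by right; rewrite mem_lcoset mulKg.
  case=> /lcosetP[u Iu ->].
    by apply: mulI => //; apply: commK; case/setIdP: Iu.
  apply: mulI; rewrite ?groupV ?orderV //.
  by apply/commute_sym/commuteV/commute_sym/commK; case/setIdP: Iu.
have expI s u : commute s u -> u \in I -> (s * u) ^+ 4 = s ^+ 4.
  move=> csu; rewrite !inE => /andP[_ /eqP ou].
  by rewrite expgMn // (expgM u 2 2) -[X in u ^+ X]ou expg_order expg1n mulg1.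
(* Fourth powers recover the factor of order 3, and [t] differs from [t^-1]. *)
have disjE6: t *: I :&: t^-1 *: I = set0.
  apply/setP=> y; rewrite !inE; apply/negP=> /andP[/lcosetP[u Iu ->] /lcosetP[v Iv]].
  have [/setIdP[Ku _] /setIdP[Kv _]] := (Iu, Iv).
  move/(congr1 (expgn^~ 4)).
  rewrite (expI _ _ (commK u Ku) Iu) (expI _ _ _ Iv); last first.
    exact/commute_sym/commuteV/commute_sym/commK.
  rewrite expgVn t4 => /eqP; rewrite eq_sym eq_invg_mul -expg2 -order_dvdn ot.
  by [].
have := card_elements_of_order G 6; rewrite -/(a 6) defE6 cardsU disjE6 cards0.
rewrite !card_lcoset subn0 addnn -muln2 => /eqP.
have -> : totient 6 = 2 by []; rewrite eqn_pmul2r // => /eqP cardI.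
have: 2 %| #|'Ldiv_2(K)|.
  apply: Frobenius_Ldiv; have [y Gy oy] := cyclic_subgroups_of_gt0 a6_gt0.
  have [|Iy _] := splitE6 y; first by rewrite inE Gy oy.
  by have /setIdP[Ky3 /eqP <-] := Iy; rewrite order_dvdG.
have ->: 'Ldiv_2(K) = 1 |: I.
  apply/setP=> x; apply/LdivP/setU1P => [[Kx x2]|[->|/setIdP[Kx /eqP <-]]].
  - have [->|ntx] := eqVneq x 1; [by left | right].
    by apply/setIdP; rewrite Kx (nt_prime_order _ x2 ntx).
  - by rewrite group1 expg1n.
  by rewrite expg_order.
rewrite cardsU1 inE order1 andbF cardI dvdn2 /= negbK.
by [].
Qed.

Lemma order_12_structure : a 7 = 0 ->
  exists t d, [/\ t \in G, d \in G, #[t] = 3, #[d] = 4 & t ^ d = t^-1] /\ #|G| = 12.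
Proof.
move=> a7; have a3 := order_3_unique a7.
have [t Gt ot] : exists2 t, t \in G & #[t] = 3.
  by apply: cyclic_subgroups_of_gt0; rewrite -/(a 3) a3.
have := dvdn_elements_of_order (p := 3) (n := 4) isT isT isT Gt ot.
rewrite -/(a 4); have -> : totient 4 = 2 by [].
move=> dvd4; have a6odd := order_6_odd a3 Gt ot.
(* Here [a 4 + a 6 = 4] with 3 dividing [a 4]; the oddness of [a 6] excludes [a 4 = 0], and
   [a 6 = 0] would give [a 4 = 4]. *)
have [a4 a6]: a 4 = 3 /\ a 6 = 1%N.
  by have [a6_0|/a6odd] := posnP (a 6); lia.
have [d Gd od] : exists2 d, d \in G & #[d] = 4.
  by apply: cyclic_subgroups_of_gt0; rewrite -/(a 4) a4.
have [y Gy oy] : exists2 y, y \in G & #[y] = 6.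
  by apply: cyclic_subgroups_of_gt0; rewrite -/(a 6) a6.
pose K := 'C_G[t]%G; have sKG: K \subset G := subsetIl _ _.
have Yt: t \in <[y]>.
  apply: (subsetP (cycleX y 2)).
  by apply: cyclic_subgroups_of_eq1_mem a3 (groupX 2 Gy) Gt _ ot; rewrite orderXdiv oy.
have Y6 z : z \in G -> #[z] = 6 -> z \in <[y]>.
  by move=> Gz; apply: cyclic_subgroups_of_eq1_mem a6 Gy Gz oy.
(* The product [t * k] has order [3 * #[k]], at most 8. *)
have ltK k : k \in K -> coprime 3 #[k] -> #[k] < 3.
  case/setIP=> Gk /cent1P cKt co3; have := order_leq8 cG (groupM Gt Gk).
  by rewrite orderM ?ot //; lia.
have sKY: K \subset <[y]>.
  apply/subsetP=> k Kk; have /setIP[Gk /cent1P cKt] := Kk.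
  have: [|| #[k] == 1%N, #[k] == 2, #[k] == 3 | #[k] == 6].
    have := ltK k Kk; have := order_leq8 cG Gk; have := order_gt0 k.
    by case: #[k] => [|[|[|[|[|[|[|[|[|n]]]]]]]]] // _ _ /(_ isT).
  case/or4P=> /eqP ok.
  - by move/eqP: ok; rewrite order_eq1 => /eqP->.
  - rewrite -(groupMl _ Yt); apply: Y6; first exact: groupM.
    by rewrite orderM ?ot ?ok.
  - by rewrite -cycle_subG -(cyclic_subgroups_of_eq1 a3 Gt Gk ot ok) cycle_subG.
  exact: Y6.
have tot_t: totient #[t] = 2 by rewrite ot.
have nTG := cyclic_subgroups_of_eq1_norm a3 Gt ot.
have iK: #|G : K| <= 2 by apply: index_cent1_totient2.
have oG: #|G| = 12.
  apply/eqP; rewrite eqn_leq; apply/andP; split.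
    rewrite -(Lagrange sKG) (@leq_mul _ _ 6 2) //.
    by rewrite -oy orderE subset_leq_card.
  by rewrite dvdn_leq // (@Gauss_dvd 3 4) // -{1}ot -od !order_dvdG.
exists t, d; split=> //; split=> //.
case: (conjg_totient2 tot_t (subsetP nTG d Gd)) => // /conjg_fixP/commgP ctd.
have: #[d] < 3 by apply: ltK; rewrite ?od // inE Gd; apply/cent1P.
by rewrite od.
Qed.

End Forward.

(** * The converse: counting in the three groups *)

Section CardCyclicSubgroups.

Variables (gT : finGroupType) (G Y : {group gT}).

Lemma card_cyclic_subgroups_cyclic_eq :
  cyclic G -> #|cyclic_subgroups G| = size (divisors #|G|).
Proof.
move=> cycG; apply/eqP; rewrite eqn_leq card_cyclic_subgroups_cyclic //=.
rewrite [leqRHS]cardE -(size_map (fun C : {group gT} => #|C|)).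
apply: uniq_leq_size (divisors_uniq _) _ => n; rewrite -dvdn_divisors //.
case/cyclicP: cycG => x defG; rewrite {1}defG -orderE => dv_n.
apply/mapP; exists <[x ^+ (#[x] %/ n)]>%G.
  by rewrite mem_enum cycle_cyclic_subgroups // groupX // defG cycle_id.
by rewrite -orderE orderXdiv ?dvdn_div // divnA // mulKn.
Qed.

(** The cyclic subgroups not contained in [Y] have order [n], and their generators are exactly the
    elements of [G :\: Y]. *)
Lemma card_cyclic_subgroups_outside n :
    Y \subset G -> {in G :\: Y, forall x, #[x] = n} ->
  #|cyclic_subgroups G| * totient n + #|Y| = #|cyclic_subgroups Y| * totient n + #|G|.
Proof.
move=> sYG outY; pose S := cyclic_subgroups G.
have defY: S :&: [set C : {group gT} | C \subset Y] = cyclic_subgroups Y.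
  apply/setP=> C; rewrite !inE.
  by case sCY: (C \subset Y); rewrite ?andbF ?andbT //= (subset_trans sCY).
have outS C : C \in S :\: [set C : {group gT} | C \subset Y] -> totient #|C| = totient n.
  rewrite !inE => /and3P[sCY sCG /cyclicP[x defC]].
  rewrite defC -orderE outY // inE -cycle_subG -defC sCY.
  by rewrite -cycle_subG -defC.
have := sum_totient_cyclic_subgroups G.
rewrite (big_setID [set C : {group gT} | C \subset Y]) /= defY.
rewrite sum_totient_cyclic_subgroups (eq_bigr _ outS) sum_nat_const => <-.
rewrite -(cardsID [set C : {group gT} | C \subset Y] S) defY.
by rewrite mulnDl -!addnA [X in (_ + X)%N]addnC.
Qed.

End CardCyclicSubgroups.

Section InvertedCycle.

Variables (gT : finGroupType) (x y : gT).
Hypothesis xy : x ^ y = x^-1.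

Lemma conjg_expg_inverted j : x ^ (y ^+ j) = if odd j then x^-1 else x.
Proof.
elim: j => [|j IHj]; first by rewrite conjg1.
by rewrite expgSr conjgM IHj /=; case: (odd j) => /=; rewrite ?conjVg xy ?invgK.
Qed.

Lemma sqrg_inverted i j : odd j -> (x ^+ i * y ^+ j) ^+ 2 = y ^+ (j * 2).
Proof.
move=> odd_j; rewrite expgS expg1 {1}(conjgC (x ^+ i)) conjXg conjg_expg_inverted odd_j.
by rewrite expgVn -!mulgA mulKg -expgD addnn -muln2.
Qed.

Lemma mulg_cycle_inverted : <[x]> <*> <[y]> = <[x]> * <[y]>.
Proof.
by rewrite norm_joinEr // cycle_subG inE -cycleJ xy cycleV.
Qed.

End InvertedCycle.

Lemma C7_count (gT : finGroupType) (G : {group gT}) :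
  G \isog Zp 7 -> #|cyclic_subgroups G| + 5 = #|G|.
Proof.
move=> isoG; have oG: #|G| = 7 by rewrite (card_isog isoG) card_Zp.
have cycG: cyclic G by apply: prime_cyclic; rewrite oG.
by rewrite card_cyclic_subgroups_cyclic_eq // oG.
Qed.

Lemma D14_count (gT : finGroupType) (G : {group gT}) :
  G \isog 'D_14 -> #|cyclic_subgroups G| + 5 = #|G|.
Proof.
move=> isoG; have oG: #|G| = 14 by rewrite (card_isog isoG) (@card_dihedral 7).
have:= isoGrp_hom (isoGrp_trans isoG (@Grp_dihedral 7 isT)).
case/existsP=> [[x y]] /= /eqP[defG x7 y2 xy].
have eqG := mulg_cycle_inverted xy; rewrite defG in eqG.
have dv_x: #[x] %| 7 by rewrite order_dvdn x7.
(* The relations only bound the orders; [#|G| = 14] then rules out [#[x] = 1]. *)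
have dv_y: #[y] %| 2 by rewrite order_dvdn y2.
have ox: #[x] = 7.
  have le_y: #[y] <= 2 by apply: dvdn_leq.
  have := mul_cardG <[x]> <[y]>; rewrite -eqG oG -!orderE.
  have := cardG_gt0 (<[x]> :&: <[y]>).
  move: dv_x; rewrite dvdn_divisors // !inE => /orP[] /eqP -> //; lia.
have sXG: <[x]> \subset G by rewrite eqG mulG_subl.
have out2: {in G :\: <[x]>, forall z, #[z] = 2}.
  move=> z; case/setDP; rewrite eqG => /mulsgP[_ _ /cycleP[i ->] /cycleP[j ->] ->] Xz.
  have odd_j: odd j.
    apply: contraR Xz; rewrite -dvdn2 => /dvdnP[k ->].
    by rewrite mulnC expgM y2 expg1n mulg1 mem_cycle.
  apply: nt_prime_order; rewrite // ?(sqrg_inverted xy) //.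
    by rewrite mulnC expgM y2 expg1n.
  by apply: contra Xz => /eqP->; apply: group1.
have := card_cyclic_subgroups_outside sXG out2.
rewrite (card_cyclic_subgroups_cyclic_eq (cycle_cyclic x)) -orderE ox oG.
have -> : totient 2 = 1%N by [].
have -> : size (divisors 7) = 2 by [].
by move: #|_| => c; lia.
Qed.

(** An internal description of the dicyclic group of order 12, through which both directions
    pass. *)
Definition Dic3_generators (gT : finGroupType) (G : {group gT}) (t d : gT) :=
  [/\ t \in G, d \in G, #[t] = 3, #[d] = 4 & t ^ d = t^-1] /\ #|G| = 12.

Lemma Dic3_mulG (gT : finGroupType) (G : {group gT}) t d :
  Dic3_generators G t d -> <[t]> * <[d]> = G.
Proof.
move=> [[Gt Gd ot od td] oG]; apply/eqP; rewrite eqEcard mul_subG ?cycle_subG //=.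
by rewrite coprime_cardMg -!orderE ot od ?oG.
Qed.

Lemma Dic3_count (gT : finGroupType) (G : {group gT}) t d :
  Dic3_generators G t d -> #|cyclic_subgroups G| + 5 = #|G|.
Proof.
move=> gen_td; have defG := Dic3_mulG gen_td.
case: gen_td => [[Gt Gd ot od td] oG].
have ctd2: commute t (d ^+ 2).
  by apply/commgP/conjg_fixP; rewrite (conjg_expg_inverted td).
have od2: #[d ^+ 2] = 2 by rewrite orderXdiv od.
(* This generates the cyclic subgroup of index 2; elements outside it involve an odd power of [d]
   and have order 4. *)
pose y := t * d ^+ 2.
have oy: #[y] = 6 by rewrite orderM ?ot ?od2.
have sYG: <[y]> \subset G by rewrite cycle_subG groupM ?groupX.
have defY: <[y]> = <[t]> * <[d ^+ 2]>.
  by rewrite cycleM ?ot ?od2.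
have out4: {in G :\: <[y]>, forall z, #[z] = 4}.
  move=> z; case/setDP; rewrite -defG => /mulsgP[_ _ /cycleP[i ->] /cycleP[j ->] ->] Yz.
  have odd_j: odd j.
    apply: contraR Yz; rewrite -dvdn2 defY => /dvdnP[k ->].
    by rewrite mulnC expgM mem_mulg ?mem_cycle.
  have: #[t ^+ i * d ^+ j] %| 4.
    rewrite order_dvdn (expgM _ 2 2) (sqrg_inverted td) // -expgM -mulnA.
    by rewrite -[(2 * 2)%N]od mulnC expgM expg_order expg1n.
  have: ~~ (#[t ^+ i * d ^+ j] %| 2).
    by rewrite order_dvdn (sqrg_inverted td) // -order_dvdn od (@dvdn_pmul2r 2 2) // dvdn2 negbK.
  by move=> /[swap]; rewrite [_ %| 4]dvdn_divisors // !inE => /or3P[] /eqP->.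
have := card_cyclic_subgroups_outside sYG out4.
rewrite (card_cyclic_subgroups_cyclic_eq (cycle_cyclic y)) -orderE oy oG.
have -> : totient 4 = 2 by [].
have -> : size (divisors 6) = 4 by [].
by move: #|_| => c; lia.
Qed.

(** * The semidirect product with inversion as a model *)

Lemma expg_Zp_morphM (gT : finGroupType) (x : gT) n :
  x ^+ n.+2 = 1 -> {in [set: 'Z_n.+2] &, {morph (fun i : 'Z_n.+2 => x ^+ i) : i j / i * j}}.
Proof.
by move=> xn i j _ _; rewrite -expgD -(expg_mod (i + j) xn).
Qed.

(** The map from C_4 onto Aut C_3, read off the parity of the residue modulo 4. *)
Definition inversion_act (x : 'Z_3) (a : 'Z_4) : 'Z_3 := if odd a then x^-1 else x.

Lemma inversion_is_action : is_action [set: 'Z_4] inversion_act.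
Proof.
split=> [a x y | x a b _ _]; rewrite /inversion_act.
  by case: (odd a) => // /invg_inj.
have ->: odd (a * b)%g = odd ((a + b)%N %% 4) by [].
rewrite odd_mod // oddD.
by case: (odd a); case: (odd b); rewrite ?invgK.
Qed.

Definition inversion_action := Action inversion_is_action.

Lemma inversion_is_groupAction : is_groupAction [set: 'Z_3] inversion_action.
Proof.
move=> a _; rewrite /= inE; apply/andP; split.
  by apply/subsetP=> x _; rewrite inE.
apply/morphicP=> x y _ _; rewrite !actpermE /= /inversion_act.
by case: (odd a) => //; rewrite invMg; apply: Zp_mulgC.
Qed.

Definition inversion_groupAction := GroupAction inversion_is_groupAction.

Lemma inversion_nontrivial : nontrivial_action inversion_groupAction.
Proof. by exists Zp1, Zp1; rewrite !inE; split. Qed.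

Lemma card_sdprod_by (aT rT : finGroupType) (D : {group aT}) (R : {group rT})
  (to : groupAction D R) : #|[set: sdprod_by to]| = (#|R| * #|D|)%N.
Proof.
rewrite -(sdprod_card (sdprod_sdpair to)).
by rewrite (card_injm (injm_sdpair1 to)) // (card_injm (injm_sdpair2 to)).
Qed.

(** The power maps to [t] and [d] respect the actions, so they glue to a morphism onto [G]; equal
    orders make it an isomorphism. *)
Lemma Dic3_isog (gT : finGroupType) (G : {group gT}) t d :
  Dic3_generators G t d -> G \isog [set: sdprod_by inversion_groupAction].
Proof.
move=> gen_td; have defG := Dic3_mulG gen_td.
case: gen_td => [[Gt Gd ot od td] oG].
have t3: t ^+ 3 = 1 by rewrite -ot expg_order.
have d4: d ^+ 4 = 1 by rewrite -od expg_order.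
pose ft := Morphism (expg_Zp_morphM (n := 1) t3).
pose fd := Morphism (expg_Zp_morphM (n := 2) d4).
have act_td : {in [set: 'Z_3] & [set: 'Z_4], morph_act inversion_groupAction 'J ft fd}.
  move=> x a _ _ /=; rewrite conjXg (conjg_expg_inverted td) /inversion_act.
  case: (odd a) => //; rewrite expgVn; apply/eqP; rewrite eq_sym eq_invg_mul.
  rewrite -(expg_Zp_morphM (n := 1) t3) ?inE // mulgV.
  by [].
have im_f: xsdprodm act_td @* [set: sdprod_by inversion_groupAction] = G.
  rewrite im_xsdprodm -defG; congr (_ * _); apply/eqP; rewrite eqEsubset.
    rewrite cycle_subG; apply/andP; split.
      by apply/subsetP=> _ /morphimP[i _ _ ->]; apply: mem_cycle.
    by apply/morphimP; exists Zp1; rewrite ?inE.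
  rewrite cycle_subG; apply/andP; split.
    by apply/subsetP=> _ /morphimP[i _ _ ->]; apply: mem_cycle.
  by apply/morphimP; exists Zp1; rewrite ?inE.
rewrite isogEcard card_sdprod_by !cardsT !card_ord oG andbT.
by apply/homgP; exists (xsdprod_morphism act_td).
Qed.

Lemma sdprod_Dic3 (gT : finGroupType) (G : {group gT})
    (to : groupAction [set: 'Z_4] [set: 'Z_3]) :
    nontrivial_action to -> G \isog [set: sdprod_by to] ->
  exists t d, Dic3_generators G t d.
Proof.
case=> a [x [_ _ ntx]]; rewrite isog_sym => /isogP[f injf imf].
have oG: #|G| = 12.
  by rewrite -imf card_injm ?subsetT // card_sdprod_by !cardsT !card_ord.
pose t := sdpair1 to x; pose d := sdpair2 to Zp1.
have ot: #[t] = 3.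
  rewrite (order_injm (injm_sdpair1 to)) ?inE //.
  have := order_dvdG (in_setT x); rewrite cardsT card_ord => dv_x.
  apply: nt_prime_order => //; first by apply/eqP; rewrite -order_dvdn.
  (* An automorphism fixes 1, so the moved element [x] is nontrivial. *)
  by apply/eqP=> x1; case: ntx; rewrite x1 gact1 ?inE.
have od: #[d] = 4.
  by rewrite (order_injm (injm_sdpair2 to)) ?inE // order_Zp1.
have td: t ^ d = t^-1.
  have t_td: t ^ d \in <[t]>.
    have defT: <[t]> = sdpair1 to @* [set: 'Z_3].
      apply/eqP; rewrite eqEcard cycle_subG mem_morphim ?inE //=.
      by rewrite (card_injm (injm_sdpair1 to)) // cardsT card_ord -orderE ot.
    rewrite defT memJ_norm; first by rewrite -defT cycle_id.
    by apply: (subsetP (im_sdpair_norm to)); rewrite mem_morphim ?inE.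
  have [|//|//|td|//] := @cycle_generator_totient2 _ t (t ^ d); rewrite ?orderJ ?ot //.
  (* If [d] centralized [t], so would the power of [d] that is the image of [a], and [a] would fix
     [x]. *)
  case: ntx; apply: (injmP (injm_sdpair1 to)); rewrite ?inE //=.
  rewrite sdpair_act ?inE // -[a]Zp1_expgz morphX ?inE //.
  by apply/conjg_fixP/commgP/commuteX/commgP/conjg_fixP.
exists (f t), (f d); split=> //.
rewrite -imf; split; rewrite ?mem_morphim ?inE // ?(order_injm injf) ?inE //.
by rewrite -morphJ ?inE // td morphV ?inE.
Qed.

Theorem theorem5 (gT : finGroupType) (G : {group gT}) :
  (#|cyclic_subgroups G| + 5 = #|G|)%N <->
  [\/ G \isog Zp 7,
      G \isog 'D_14
    | exists2 to : groupAction [set: 'Z_4] [set: 'Z_3],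
        nontrivial_action to & G \isog [set: sdprod_by to]].
Proof.
split=> [cG | [| | [to nt_to isoG]]]; last 1 first.
- by have [t [d /Dic3_count]] := sdprod_Dic3 nt_to isoG.
- have [a7|a7_gt0] := posnP #|cyclic_subgroups_of G 7|; last first.
    by case: (order_7_classification cG a7_gt0) => isoG; [apply: Or31 | apply: Or32].
  have [t [d /Dic3_isog isoG]] := order_12_structure cG a7.
  by apply: Or33; exists inversion_groupAction; first exact: inversion_nontrivial.
- exact: C7_count.
exact: D14_count.
Qed.
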